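(* Let $n\ge 2$. Among all phenylene chains with $n$ hexagons and $n-1$ squares, the helicene phenylene chain $H_n=G(0,0,\ldots,0)$ has the minimum Kirchhoff index; that is, for every $w\in\{0,1,2\}^{n-2}$, $$K\!f(H_n)\le K\!f(G(w)).$$
   Context: All graphs are simple and connected. For vertices $u,v$ of a connected graph $G$, the resistance distance $r_G(u,v)$ is the effective resistance between $u$ and $v$ in the electrical network obtained from $G$ by replacing each edge with a unit resistor. The Kirchhoff index is $K\!f(G)=\sum_{\{u,v\}\subseteq V(G)} r_G(u,v)$, the sum being over all unordered pairs of distinct vertices. Phenylene chains with $n$ hexagons and $n-1$ squares ($n\ge 2$) are represented as the (abstract) graphs $G(w)$, $w=(w_1,\ldots,w_{n-2})\in\{0,1,2\}^{n-2}$, constructed as follows. Let $Q_{2n-1}$ be the ladder graph with $2n-1$ squares: it has top vertices $t_1,\ldots,t_{2n}$, bottom vertices $s_1,\ldots,s_{2n}$, and edges $t_jt_{j+1}$ and $s_js_{j+1}$ for $1\le j\le 2n-1$, together with $t_js_j$ for $1\le j\le 2n$. Its $j$-th square $S_j$ is the 4-cycle $t_jt_{j+1}s_{j+1}s_j$, with top edge $t_jt_{j+1}$ and bottom edge $s_js_{j+1}$. ''Adding $m$ vertices to an edge'' means subdividing that edge $m$ times, i.e. replacing it by a path with $m$ new internal vertices ($m=0$ leaves the edge unchanged). The graph $G(w)$ is obtained from $Q_{2n-1}$ by adding two vertices to each odd-indexed square $S_1,S_3,\ldots,S_{2n-1}$, turning each of them into a hexagon, as follows: - for the two end squares $S_1$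 and $S_{2n-1}$, two vertices are added to the bottom edge; - for $1\le i\le n-2$, in the square $S_{2i+1}$, $w_i$ vertices are added to the top edge and $2-w_i$ vertices are added to the bottom edge. The even-indexed squares are left unchanged. The helicene phenylene chain is $H_n=G(0,0,\ldots,0)$ (with $n-2$ zeros; for $n=2$ the vector $w$ is empty). *)

(* Defs.v *)
From HB Require Import structures.
From mathcomp Require Import all_boot all_order all_algebra.
From mathcomp Require Import boolp classical_sets reals ring lra.

Set Implicit Arguments.
Unset Strict Implicit.
Unset Printing Implicit Defensive.

Import Order.TTheory GRing.Theory Num.Theory.
Local Open Scope ring_scope.

Section Resistance.
Variables (R : realType) (T : finType) (adj : rel T).

(* Node potentials under a unit current entering at u and leaving at v:
   Ohm's law for unit resistors makes f x - f y the current from x to y along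
   an edge, and Kirchhoff's current law is imposed at every vertex. *)
Definition unit_current_potential (u v : T) (f : T -> R) : Prop :=
  forall x, \sum_(y | adj x y) (f x - f y) = (x == u)%:R - (x == v)%:R.

(* The voltage drop from u to v under a unit current. On a connected graph it
   exists and does not depend on the potential (ex_unit_current_potential and
   resistanceE below), so the default value 0 is not used. *)
Definition resistance (u v : T) : R :=
  xget 0 [set r | exists2 f, unit_current_potential u v f & r = f u - f v]%classic.

(* Each unordered pair of distinct vertices is listed once, in the order of the
   enumeration of T. *)
Definition kirchhoff_index : R :=
  \sum_(p : T * T | (enum_rank p.1 < enum_rank p.2)%N) resistance p.1 p.2.

Definition connected_graph : Prop := forall x y, connect adj x y.

Lemma harmonic_constant (g : T -> R) :
    symmetric adj -> connected_graph ->
    (forall x, \sum_(y | adj x y) (g x - g y) = 0) ->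
  forall x y, g x = g y.
Proof.
move=> adjC adjT g0.
have E0 : \sum_x \sum_(y | adj x y) g x * (g x - g y) = 0.
  by apply: big1 => x _; rewrite -mulr_sumr g0 mulr0.
have E1 : \sum_x \sum_(y | adj x y) g y * (g y - g x) = 0.
  rewrite -[RHS]E0 [LHS](exchange_big_dep predT) //=.
  by apply: eq_bigr => x _; under eq_bigl do rewrite adjC.
have E2 : \sum_x \sum_(y | adj x y) (g x - g y) ^+ 2 = 0.
  transitivity (\sum_x \sum_(y | adj x y) g x * (g x - g y) +
                \sum_x \sum_(y | adj x y) g y * (g y - g x)).
    rewrite -big_split; apply: eq_bigr => x _ /=.
    by rewrite -big_split; apply: eq_bigr => y _ /=; ring.
  by rewrite E0 E1 addr0.
have nn x : 0 <= \sum_(y | adj x y) (g x - g y) ^+ 2.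
  by apply: sumr_ge0 => y _; apply: sqr_ge0.
have step x y : adj x y -> g x = g y.
  move=> xy.
  have /psumr_eq0P/(_ x isT) Ex := E2.
  have {}Ex : \sum_(y | adj x y) (g x - g y) ^+ 2 = 0 by apply: Ex => ? _.
  have /psumr_eq0P/(_ y xy) Exy := Ex.
  have /eqP : (g x - g y) ^+ 2 = 0 by apply: Exy => ? _; apply: sqr_ge0.
  by rewrite sqrf_eq0 subr_eq0 => /eqP.
move=> x y; have /connectP[p] := adjT x y.
elim: p x => [|z p IHp] x /=; first by move=> _ ->.
by case/andP=> /step -> /IHp.
Qed.

Lemma resistanceE (u v : T) (f : T -> R) :
    symmetric adj -> connected_graph -> unit_current_potential u v f ->
  resistance u v = f u - f v.
Proof.
move=> adjC adjT fP; rewrite /resistance; case: xgetP => [_ -> [g gP ->]|].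
  have fg : f u - g u = f v - g v.
    apply: (@harmonic_constant (fun x => f x - g x) adjC adjT) => x.
    transitivity (\sum_(y | adj x y) (f x - f y) -
                  \sum_(y | adj x y) (g x - g y)).
      by rewrite -sumrB; apply: eq_bigr => y _; ring.
    by rewrite fP gP subrr.
  by lra.
by move=> /(_ (f u - f v))[]; exists f.
Qed.

Lemma ex_unit_current_potential (u v : T) :
    symmetric adj -> connected_graph ->
  exists f : T -> R, unit_current_potential u v f.
Proof.
move=> adjC adjT.
pose L : 'M[R]_#|T| := \matrix_(i, j)
  ((i == j)%:R * #|adj (enum_val i)|%:R - (adj (enum_val i) (enum_val j))%:R).
have LC : L^T = L.
  apply/matrixP => i j; rewrite !mxE adjC [j == i]eq_sym.
  by case: eqVneq => [->|]; rewrite ?mul0r.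
have LE (c : 'I_#|T| -> R) i : \sum_j L i j * c j =
    \sum_(y | adj (enum_val i) y) (c i - c (enum_rank y)).
  under eq_bigr => j _ do rewrite mxE mulrBl.
  rewrite sumrB sumrB; congr (_ - _).
    rewrite (bigD1 i) //= eqxx mul1r big1 ?addr0.
      by rewrite sumr_const mulr_natl.
    by move=> j /negPf; rewrite eq_sym => ->; rewrite !mul0r.
  rewrite (reindex (@enum_rank T)) /=; last first.
    by exists enum_val => ? _; rewrite ?enum_rankK ?enum_valK.
  rewrite [RHS]big_mkcond; apply: eq_bigr => y _; rewrite enum_rankK.
  by case: (adj _ y); rewrite ?mul1r ?mul0r.
pose b : 'rV[R]_#|T| := \row_i ((enum_val i == u)%:R - (enum_val i == v)%:R).
have bL : (b <= L)%MS.
  rewrite submxE; apply/eqP/rowP => k; rewrite !mxE.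
  have K0 i : \sum_j L i j * cokermx L j k = 0.
    by have /matrixP/(_ i k) := mulmx_coker L; rewrite !mxE.
  have Kc : forall x y, cokermx L (enum_rank x) k = cokermx L (enum_rank y) k.
    apply: (@harmonic_constant (fun x => cokermx L (enum_rank x) k) adjC adjT).
    move=> x; have := K0 (enum_rank x).
    by rewrite (LE (fun j => cokermx L j k)) enum_rankK.
  have sd z : \sum_(j < #|T|) ((enum_val j == z)%:R : R) = 1.
    rewrite (bigD1 (enum_rank z)) //= enum_rankK eqxx big1 ?addr0 // => j jz.
    case: eqP => // jE; case/negP: jz.
    by rewrite -jE enum_valK.
  transitivity (\sum_j (b 0 j * cokermx L (enum_rank u) k)).
    by apply: eq_bigr => j _; rewrite -[in LHS](enum_valK j) (Kc _ u) enum_valK.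
  rewrite -mulr_suml; under eq_bigr => j _ do rewrite mxE.
  by rewrite sumrB !sd subrr mul0r.
have := mulmxKpV bL; set f := b *m _ => fL.
exists (fun x => f 0 (enum_rank x)) => x.
have : (f *m L) 0 (enum_rank x) = b 0 (enum_rank x) by rewrite fL.
rewrite [RHS]mxE enum_rankK => <-; rewrite [RHS]mxE.
have := LE (f 0) (enum_rank x); rewrite enum_rankK => LEx.
rewrite -[LHS]LEx; apply: eq_bigr => j _.
by rewrite -[in LHS]LC mxE mulrC.
Qed.

End Resistance.

Section Subdivision.
Variables (V E : finType) (src tgt : E -> V) (m : E -> nat).

Definition subdiv_vertex : finType := (V + {e : E & 'I_(m e)})%type.

(* The k-th point of the path replacing e: k = 0 is src e, 1 <= k <= m e are
   the new vertices, and k = (m e).+1 is tgt e. *)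
Definition subdiv_point (e : E) (k : nat) : subdiv_vertex :=
  if k is k'.+1 then
    if insub k' : option 'I_(m e) is Some i then inr (Tagged _ i)
    else inl (tgt e)
  else inl (src e).

Definition subdiv : rel subdiv_vertex := fun x y =>
  [exists e, exists k : 'I_(m e).+1,
    ((x == subdiv_point e k) && (y == subdiv_point e k.+1)) ||
    ((y == subdiv_point e k) && (x == subdiv_point e k.+1))].

Lemma subdiv_sym : symmetric subdiv.
Proof.
by move=> x y; apply: eq_existsb => e; apply: eq_existsb => k; rewrite orbC.
Qed.

Lemma subdiv_point_last (e : E) : subdiv_point e (m e).+1 = inl (tgt e).
Proof. by rewrite /subdiv_point insubF // ltnn. Qed.

Lemma subdiv_irr : (forall e, src e != tgt e) -> irreflexive subdiv.
Proof.
move=> st x; apply/existsP => -[e /existsP[k]]; rewrite orbb.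
case/andP=> /eqP-> /eqP; case: k => -[|k] /= kP.
  by case: insubP => //= _ [] /eqP; apply/negP.
rewrite insubT; case: insubP => //= i _ iE /(@inr_inj _ _ _ _) /eqP.
by rewrite eq_Tagged /= -val_eqE /= iE; elim: (k).
Qed.

Lemma subdiv_connect_point e k :
  (k <= (m e).+1)%N -> connect subdiv (inl (src e)) (subdiv_point e k).
Proof.
elim: k => [|k IHk] km; first exact: connect0.
apply: connect_trans (IHk (ltnW km)) (connect1 _).
by apply/existsP; exists e; apply/existsP; exists (Ordinal km); rewrite !eqxx.
Qed.

Lemma subdiv_connected (v0 : V) :
    (forall v, connect (fun x y => [exists e, (src e == x) && (tgt e == y)])
      v0 v) ->
  connected_graph subdiv.
Proof.
move=> Vconn.
have base v : connect subdiv (inl v0) (inl v).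
  have /connectP[p] := Vconn v.
  elim/last_ind: p v => [|p z IHp] v; first by move=> _ ->; apply: connect0.
  rewrite rcons_path last_rcons => /andP[pP /existsP[e /andP[/eqP es /eqP et]]].
  move=> ->; apply: connect_trans (IHp _ pP erefl) _.
  by rewrite -es -et -subdiv_point_last; apply: subdiv_connect_point.
have all0 x : connect subdiv (inl v0) x.
  case: x => [v|[e i]]; first exact: base.
  apply: connect_trans (base (src e)) _.
  have -> : inr (Tagged (fun e => 'I_(m e)) i) = subdiv_point e i.+1.
    by rewrite /subdiv_point valK.
  by apply: subdiv_connect_point; apply: ltnW; rewrite ltnS ltn_ord.
move=> x y; apply: connect_trans (all0 y).
by rewrite (sym_connect_sym subdiv_sym).
Qed.

End Subdivision.

Section Ladder.
Variable k : nat.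

(* The ladder with k squares. (b, j) is the vertex t_(j+1) if b = true and
   s_(j+1) if b = false; inl (b, j) is the top (b = true) or bottom edge of the
   square S_(j+1), and inr j is the rung t_(j+1) s_(j+1). *)
Definition ladder_vertex : finType := (bool * 'I_k.+1)%type.
Definition ladder_edge : finType := ((bool * 'I_k) + 'I_k.+1)%type.

Definition ladder_src (e : ladder_edge) : ladder_vertex :=
  match e with
  | inl (b, j) => (b, widen_ord (leqnSn k) j)
  | inr j => (true, j)
  end.

Definition ladder_tgt (e : ladder_edge) : ladder_vertex :=
  match e with
  | inl (b, j) => (b, lift ord0 j)
  | inr j => (false, j)
  end.

End Ladder.

Section Phenylene.
Variables (n : nat) (w : (n - 2)%N.-tuple 'I_3).

(* Number of vertices added to the top edge of S_(2i+1), 0 <= i <= n-1; the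
   letter w_i is stored at position i-1 of the tuple. *)
Definition top_added (i : nat) : nat :=
  if (0 < i < n.-1)%N then nat_of_ord (nth ord0 w i.-1) else 0%N.

Definition added (e : ladder_edge (2 * n - 1)%N) : nat :=
  match e with
  | inl (b, j) =>
      if odd j then 0%N
      else if b then top_added j./2 else (2 - top_added j./2)%N
  | inr _ => 0%N
  end.

Definition phenylene_vertex : finType :=
  subdiv_vertex (ladder_vertex (2 * n - 1)%N) added.

Definition phenylene : rel phenylene_vertex :=
  @subdiv _ _ (@ladder_src _) (@ladder_tgt _) added.

Lemma phenylene_sym : symmetric phenylene.
Proof. exact: subdiv_sym. Qed.

Lemma phenylene_irr : irreflexive phenylene.
Proof.
apply: subdiv_irr => -[[b j]|j] /=; last by [].
by rewrite xpair_eqE eqxx -val_eqE /= /bump /= add1n; elim: (val j).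
Qed.

Lemma phenylene_connected : connected_graph phenylene.
Proof.
apply: (@subdiv_connected _ _ _ _ _ (true, ord0)).
set e := (fun x y => _).
have top j : connect e (true, ord0) (true, j).
  case: j => j; elim: j => [|j IHj] jP.
    by rewrite (_ : Ordinal jP = ord0) ?connect0 //; apply: val_inj.
  apply: connect_trans (IHj (ltnW jP)) (connect1 _).
  apply/existsP; exists (inl (true, Ordinal (jP : (j < 2 * n - 1)%N))).
  by rewrite !xpair_eqE /= -!val_eqE /= /bump /= add1n !eqxx.
case=> -[] j; first exact: top.
apply: connect_trans (top j) (connect1 _); apply/existsP; exists (inr j).
by rewrite /= !eqxx.
Qed.

End Phenylene.

Arguments phenylene {n} w.

Definition helicene_word (n : nat) : (n - 2)%N.-tuple 'I_3 :=
  [tuple of nseq (n - 2) ord0].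

(* Main.v *)
Require Import Defs.
From mathcomp Require Import all_boot all_order all_algebra reals.
From mathcomp Require Import ring lra zify.

(** A phenylene chain grows from a single rung by two moves on a graph with two
    ports u (top) and v (bottom): hang a pendant vertex on a port, which becomes
    the new port, or join the ports by an edge. Both moves update the resistance
    matrix explicitly, so the Kirchhoff index is the last entry of a six-number
    state that evolves by rational formulas.

    If two such graphs of port resistances r1, r2 are joined by two unit edges,
    then turning the second one upside down changes the Kirchhoff index by
    d1 d2 / (r1 + r2 + 2), where d = sum_p (r(p,u) - r(p,v)). The sign of d only
    depends on the hexagon carrying the ports: d <= 0 for the letter 0 and d = 0
    for an end hexagon. Hence, after a prefix 0...0, a letter 2 may be turned into
    a 0 by flipping the whole rest of the chain. In the letter at one position the
    Kirchhoff index is concave, so that a letter 1 may be replaced by 0 or by 2. *)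

Set Implicit Arguments.
Unset Strict Implicit.
Unset Printing Implicit Defensive.

Import Order.TTheory GRing.Theory Num.Theory.
Local Open Scope ring_scope.

(** * States of two-port graphs *)

Section PortStates.
Variable R : realFieldType.

(* For a graph with ports u and v: its order, r(u,v), the sums over all vertices p
   of r(p,u) - r(p,v), of (r(p,u) - r(p,v))^2 and of r(p,u) + r(p,v), and its
   Kirchhoff index (see [port_state_of]). *)
Record port_state := PortState {
  ps_size : R; ps_res : R; ps_diff : R; ps_sqr : R; ps_sum : R; ps_kf : R }.

Definition edge_state := PortState 2 1 0 2 2 1.

Definition flip s := let: PortState n r d q t k := s in PortState n r (- d) q t k.

(** A pendant vertex x at u has r(p,x) = r(p,u) + 1 for every old p; since (t + d) / 2 is the sum of
    the r(p,u), the Kirchhoff index grows by (t + d) / 2 + n. *)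
Definition top s := let: PortState n r d q t k := s in
  PortState (n + 1) (r + 1) (d + n - (r + 1)) (q + 2 * d + n + (r + 1) ^+ 2)
    (t + n + (r + 1)) (k + (t + d) / 2 + n).

Definition bot s := flip (top (flip s)).

Definition close s := let: PortState n r d q t k := s in
  PortState n (r / (1 + r)) (d / (1 + r)) (q / (1 + r) ^+ 2)
    (t - (q + n * r ^+ 2) / (2 * (1 + r)))
    (k - (n * q - d ^+ 2) / (4 * (1 + r))).

(* The Kirchhoff index after joining top port to top port and bottom port to
   bottom port by unit edges. With D = r(.,u) - r(.,v), the edges lower r(p,p') by
   (D p - D p')^2 / (4 rho) inside a part, and across the parts a star-triangle
   reduction gives r(p,q) = (r(p,u) + r(p,v) - r1) / 2 + (r(q,x) + r(q,y) - r2) / 2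
   + (rho^2 - (D p + D q)^2) / (4 rho). *)
Definition join_kf s1 s2 :=
  let: PortState n1 r1 d1 q1 t1 k1 := s1 in
  let: PortState n2 r2 d2 q2 t2 k2 := s2 in
  let rho := r1 + r2 + 2 in
  k1 + k2 - (n1 * q1 - d1 ^+ 2) / (4 * rho) - (n2 * q2 - d2 ^+ 2) / (4 * rho)
  + n2 * (t1 - n1 * r1) / 2 + n1 * (t2 - n2 * r2) / 2 + n1 * n2 * rho / 4
  - (n2 * q1 + 2 * d1 * d2 + n1 * q2) / (4 * rho).

Definition square s := close (bot (top s)).

(** Together with the two vertices supplied by a following [square], these complete a hexagon with
    letter [k]. *)
Definition wings (k : nat) s := iter (2 - k) bot (iter k top s).

Definition hexagon k s := square (wings k s).

Lemma flipK : involutive flip.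
Proof. by case=> n r d q t k; rewrite /= opprK. Qed.

Lemma top_bot s : top (bot s) = bot (top s).
Proof. by case: s => n r d q t k /=; congr PortState; field. Qed.

(** Both sides describe one graph: the new vertex subdivides the edge between the top ports and may
    be counted in either part. *)
Lemma join_kf_top s1 s2 : 0 <= ps_res s1 -> 0 <= ps_res s2 ->
  join_kf (top s1) s2 = join_kf s1 (top s2).
Proof.
case: s1 s2 => n1 r1 d1 q1 t1 k1 [n2 r2 d2 q2 t2 k2] /= h1 h2.
by field; repeat (apply/andP; split); apply/eqP; lra.
Qed.

Lemma join_kf_flip s1 s2 : join_kf (flip s1) (flip s2) = join_kf s1 s2.
Proof.
by case: s1 s2 => n1 r1 d1 q1 t1 k1 [n2 r2 d2 q2 t2 k2] /=; rewrite !sqrrN; ring.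
Qed.

Lemma join_kf_bot s1 s2 : 0 <= ps_res s1 -> 0 <= ps_res s2 ->
  join_kf (bot s1) s2 = join_kf s1 (bot s2).
Proof.
move=> h1 h2; rewrite /bot -join_kf_flip flipK join_kf_top; last 2 first.
- by case: s1 h1.
- by case: s2 h2.
by rewrite -join_kf_flip flipK.
Qed.

(** Again one graph cut at two places: the middle rung may belong to either part. *)
Lemma join_kf_square s1 s2 : 0 <= ps_res s1 -> 0 <= ps_res s2 ->
  join_kf (square s1) s2 = join_kf s1 (square s2).
Proof.
case: s1 s2 => n1 r1 d1 q1 t1 k1 [n2 r2 d2 q2 t2 k2] /= h1 h2.
field; repeat (apply/andP; split); apply/eqP; nra.
Qed.

Lemma ps_kf_square s : 0 <= ps_res s ->
  ps_kf (square s) = join_kf s edge_state.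
Proof.
case: s => n r d q t k /= h.
field; repeat (apply/andP; split); apply/eqP; nra.
Qed.

(** Flipping only changes the sign of the cross term 2 d1 d2 in [join_kf]. *)
Lemma join_kf_flipr s1 s2 : 0 <= ps_res s1 -> 0 <= ps_res s2 ->
  join_kf s1 s2 - join_kf s1 (flip s2) =
  - (ps_diff s1 * ps_diff s2) / (ps_res s1 + ps_res s2 + 2).
Proof.
case: s1 s2 => n1 r1 d1 q1 t1 k1 [n2 r2 d2 q2 t2 k2] /= h1 h2.
field; repeat (apply/andP; split); apply/eqP; nra.
Qed.

(** Concavity in the letter: both factors on the right are nonnegative for parts of size at least 2
    and port resistance at most 1. The two wing edges turn the loop resistance r1 + r2 + 2 into r1 +
    r2 + 4. *)
Lemma join_kf_wings1 s1 s2 : 0 <= ps_res s1 -> 0 <= ps_res s2 ->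
  2 * join_kf s1 (wings 1 s2) - join_kf s1 (wings 0 s2) - join_kf s1 (wings 2 s2)
  = 2 * ((ps_size s1 - 1 - ps_res s1) * (ps_size s2 - 1 - ps_res s2))
    / (ps_res s1 + ps_res s2 + 4).
Proof.
case: s1 s2 => n1 r1 d1 q1 t1 k1 [n2 r2 d2 q2 t2 k2] /= h1 h2.
field; repeat (apply/andP; split); apply/eqP; nra.
Qed.

(** The last bound is the triangle inequality |r(p,u) - r(p,v)| <= r(u,v), summed over p. *)
Definition admissible s := [&& 0 <= ps_res s, 2 <= ps_size s &
  `|ps_diff s| <= ps_size s * ps_res s].

Lemma admissible_edge : admissible edge_state.
Proof. by rewrite /admissible /= normr0; apply/and3P; split; lra. Qed.

Lemma admissible_flip s : admissible (flip s) = admissible s.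
Proof. by case: s => n r d q t k; rewrite /admissible /= normrN. Qed.

Lemma admissible_top s : admissible s -> admissible (top s).
Proof.
case: s => n r d q t k /and3P[/= h1 h2]; rewrite ler_norml => /andP[h3 h4].
by apply/and3P; split; rewrite /= ?ler_norml; [lra | lra | apply/andP; split; nra].
Qed.

Lemma admissible_bot s : admissible s -> admissible (bot s).
Proof.
by move=> h; rewrite /bot admissible_flip admissible_top // admissible_flip.
Qed.

Lemma admissible_close s : admissible s -> admissible (close s).
Proof.
case: s => n r d q t k /and3P[/= h1 h2 h3]; apply/and3P; split => //=.
  by rewrite divr_ge0 // addr_ge0.
by rewrite normrM normfV (ger0_norm (addr_ge0 ler01 h1)) mulrA ler_pM2r // invr_gt0; lra.
Qed.

Lemma admissible_square s : admissible s -> admissible (square s).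
Proof. by move=> h; apply/admissible_close/admissible_bot/admissible_top. Qed.

Lemma admissible_iter f j s : (forall s, admissible s -> admissible (f s)) ->
  admissible s -> admissible (iter j f s).
Proof. by move=> hf; elim: j => //= j IH /IH /hf. Qed.

Lemma admissible_wings k s : admissible s -> admissible (wings k s).
Proof.
move=> h; apply: admissible_iter admissible_bot _.
exact: admissible_iter admissible_top _.
Qed.

Lemma admissible_res s : admissible s -> 0 <= ps_res s.
Proof. by case/and3P. Qed.

Lemma close_res_le1 s : 0 <= ps_res s -> ps_res (close s) <= 1.
Proof. by case: s => n r d q t k /= h; rewrite ler_pdivrMr; lra. Qed.

Lemma ps_size_top s : ps_size (top s) = ps_size s + 1.
Proof. by case: s. Qed.

Lemma ps_size_bot s : ps_size (bot s) = ps_size s + 1.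
Proof. by case: s. Qed.

Lemma ps_size_close s : ps_size (close s) = ps_size s.
Proof. by case: s. Qed.

Lemma ps_size_square s : ps_size (square s) = ps_size s + 2.
Proof. by rewrite ps_size_close ps_size_bot ps_size_top; lra. Qed.

Lemma ps_size_wings (k : 'I_3) s : ps_size (wings k s) = ps_size s + 2.
Proof.
by case: k => -[|[|[|]]] //= _; rewrite /wings /= ?(ps_size_bot, ps_size_top); lra.
Qed.

(* The ports are on the outer rung of the hexagon of the first letter; the
   innermost hexagon is the end of the chain. *)
Fixpoint chain (l : seq 'I_3) : port_state :=
  if l is k :: l' then hexagon k (square (chain l')) else hexagon 0 edge_state.

Lemma chain_square l : {s | admissible s & chain l = square s}.
Proof.
elim: l => [|k l [s hs eq]] /=.
  by exists (wings 0 edge_state); rewrite // admissible_wings ?admissible_edge.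
by exists (wings k (square (chain l))); rewrite // eq admissible_wings //
   !admissible_square.
Qed.

Lemma admissible_chain l : admissible (chain l).
Proof. by have [s hs ->] := chain_square l; apply: admissible_square. Qed.

Lemma square_res_le1 s : admissible s -> ps_res (square s) <= 1.
Proof.
by move=> hs; apply/close_res_le1/admissible_res/admissible_bot/admissible_top.
Qed.

Lemma chain_size l : 6 <= ps_size (chain l).
Proof.
case: l => [|k l]; first by rewrite /=; lra.
have /and3P[_ h _] := admissible_chain l.
by rewrite [chain _]/= /hexagon ps_size_square ps_size_wings ps_size_square; lra.
Qed.

(** The numerator of the new difference is d - 2 (n - 1 - r). As d <= n r, it is at most 2 + 2 r - n
    (2 - r), which is at most 6 r - 6 <= 0 when n >= 4 and r <= 1. *)
Lemma hexagon0_diff s : admissible s -> ps_res s <= 1 -> 4 <= ps_size s ->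
  ps_diff (hexagon 0 s) <= 0.
Proof.
case: s => n r d q t k /and3P[/= h1 h2]; rewrite ler_norml => /andP[h3 h4] h5 h6.
by rewrite ler_pdivrMr ?mul0r; nra.
Qed.

Lemma chain0_diff l : ps_diff (chain (ord0 :: l)) <= 0.
Proof.
have h := admissible_chain l.
apply: hexagon0_diff; rewrite ?admissible_square ?square_res_le1 //.
by rewrite ps_size_square; have := chain_size l; lra.
Qed.

(** A single hexagon has a reflection exchanging the two ports. *)
Lemma chain_nil_diff : ps_diff (chain [::]) = 0.
Proof. by rewrite /= (_ : _ - _ = 0) ?mul0r //; ring. Qed.

Lemma nseq0_diff m : ps_diff (chain (nseq m ord0)) <= 0.
Proof. by case: m => [|m]; [rewrite chain_nil_diff | apply: chain0_diff]. Qed.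

(** * Turning chains upside down *)

Lemma iter_flip f g j s : (forall s, flip (f s) = g (flip s)) ->
  flip (iter j f s) = iter j g (flip s).
Proof. by move=> fg; elim: j => //= j <-. Qed.

Lemma flip_top s : flip (top s) = bot (flip s).
Proof. by rewrite /bot flipK. Qed.

Lemma flip_bot s : flip (bot s) = top (flip s).
Proof. by rewrite /bot flipK. Qed.

Lemma flip_close s : flip (close s) = close (flip s).
Proof. by case: s => n r d q t k /=; rewrite sqrrN mulNr. Qed.

Lemma flip_square s : flip (square s) = square (flip s).
Proof. by rewrite /square flip_close flip_bot flip_top top_bot. Qed.

Lemma iter_top_bot i j s : iter i top (iter j bot s) = iter j bot (iter i top s).
Proof.
elim: i => //= i ->; elim: j => //= j IH.
by rewrite top_bot IH.
Qed.

Lemma flip_wings (k : 'I_3) s : flip (wings k s) = wings (rev_ord k) (flip s).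
Proof.
rewrite /wings (iter_flip _ _ flip_bot) (iter_flip _ _ flip_top) iter_top_bot.
by case: k => -[|[|[|]]].
Qed.

Lemma flip_hexagon (k : 'I_3) s : flip (hexagon k s) = hexagon (rev_ord k) (flip s).
Proof. by rewrite /hexagon flip_square flip_wings. Qed.

Lemma flip_chain_nil : flip (chain [::]) = chain [::].
Proof. by rewrite /=; congr PortState; field. Qed.

(** Upside down, the letter k becomes 2 - k, which is [rev_ord]; the end hexagon is symmetric. *)
Lemma flip_chain l : flip (chain l) = chain (map (@rev_ord 3) l).
Proof.
elim: l => [|k l IH]; first exact: flip_chain_nil.
by rewrite [LHS]flip_hexagon flip_square IH.
Qed.

(** * Moving hexagons across a join *)

Lemma join_kf_iter f j s1 s2 :
  (forall s, admissible s -> admissible (f s)) ->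
  (forall s1 s2, 0 <= ps_res s1 -> 0 <= ps_res s2 ->
     join_kf (f s1) s2 = join_kf s1 (f s2)) ->
  admissible s1 -> admissible s2 ->
  join_kf (iter j f s1) s2 = join_kf s1 (iter j f s2).
Proof.
move=> hf fJ; elim: j s2 => //= j IH s2 h1 h2.
rewrite fJ ?admissible_res ?admissible_iter // IH ?hf // -iterSr.
by [].
Qed.

Lemma join_kf_wings k s1 s2 : admissible s1 -> admissible s2 ->
  join_kf (wings k s1) s2 = join_kf s1 (wings k s2).
Proof.
move=> h1 h2; rewrite /wings.
have at1 := admissible_iter k admissible_top.
have ab1 := admissible_iter (2 - k) admissible_bot.
rewrite (join_kf_iter _ admissible_bot join_kf_bot) ?at1 //.
rewrite (join_kf_iter _ admissible_top join_kf_top) ?ab1 //.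
by rewrite iter_top_bot.
Qed.

(** The junction of two chains closes a square between hexagons, so the hexagon next to it can be
    handed over: its outer rung, its wings and the square behind it cross one after the other. *)
Lemma join_kf_chain p k l :
  join_kf (chain p) (chain (k :: l)) = join_kf (chain (k :: p)) (chain l).
Proof.
have hp := admissible_chain p; have hl := admissible_chain l.
rewrite /= /hexagon join_kf_square ?admissible_res ?admissible_wings
  ?admissible_square // join_kf_wings ?admissible_square //.
by rewrite join_kf_square ?admissible_res ?admissible_wings ?admissible_square.
Qed.

Lemma ps_kf_chain k l : ps_kf (chain (k :: l)) =
  join_kf (square (chain l)) (wings k edge_state).
Proof.
have hl := admissible_chain l.
rewrite ps_kf_square ?admissible_res ?admissible_wings ?admissible_square //.
by rewrite join_kf_wings ?admissible_square ?admissible_edge.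
Qed.

(** The outer letter 0 encodes an end hexagon. Closing it is joining a single rung, onto which its
    wings and then the inner square are moved, forming [chain [::]]. *)
Lemma ps_kf_chain0 l : ps_kf (chain (ord0 :: l)) = join_kf (chain l) (chain [::]).
Proof.
have hl := admissible_chain l.
rewrite ps_kf_chain join_kf_square ?admissible_res //.
by rewrite admissible_wings ?admissible_edge.
Qed.

Lemma join_kf_rev l p : join_kf (chain (catrev l p)) (chain [::]) =
  join_kf (chain p) (chain l).
Proof. by elim: l p => //= k l IH p; rewrite IH -join_kf_chain. Qed.

Lemma join_kf_flip_le s1 s2 : admissible s1 -> admissible s2 ->
  ps_diff s1 <= 0 -> ps_diff s2 <= 0 -> join_kf s1 s2 <= join_kf s1 (flip s2).
Proof.
move=> /admissible_res h1 /admissible_res h2 d1 d2.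
rewrite -subr_le0 join_kf_flipr // mulNr oppr_le0 divr_ge0 ?mulr_le0 //; lra.
Qed.

Lemma join_kf_hexagon (k : nat) s1 s2 : admissible s1 -> admissible s2 ->
  join_kf s1 (hexagon k s2) = join_kf (square s1) (wings k s2).
Proof.
by move=> h1 h2; rewrite join_kf_square ?admissible_res ?admissible_wings.
Qed.

(** By concavity the middle letter cannot lie strictly below both extremes. *)
Lemma join_kf_hexagon1 s1 s2 : admissible s1 -> admissible s2 ->
    ps_res s2 <= 1 ->
  join_kf s1 (hexagon 0 s2) <= join_kf s1 (hexagon 1 s2) \/
  join_kf s1 (hexagon 2 s2) <= join_kf s1 (hexagon 1 s2).
Proof.
move=> h1 h2 r2; rewrite !join_kf_hexagon //.
have h1' := admissible_square h1.
have := join_kf_wings1 (admissible_res h1') (admissible_res h2).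
have r1 := square_res_le1 h1.
set x := join_kf _ _; set y := join_kf _ _; set z := join_kf _ _.
case/and3P: h1' => a1 b1 _; case/and3P: h2 => a2 b2 _ e.
have : 0 <= 2 * x - y - z.
  by rewrite e divr_ge0 ?mulr_ge0; lra.
by case: (lerP y x) => [|yx] h; [left | right; lra].
Qed.

(** The settled prefix of zeros grows on the left while the rest shrinks on the right. The induction
    is on the length, for all words at once, because a flip replaces the tail by another word of the
    same length. *)
Lemma join_kf_nseq0_le i l :
  join_kf (chain (nseq i ord0)) (chain (nseq (size l) ord0)) <=
  join_kf (chain (nseq i ord0)) (chain l).
Proof.
move sz: (size l) => m; elim: m l i sz => [|m IH] [|k l] //= i [sz].
(* Head letter 0: hand the hexagon over to the left part and use the induction hypothesis for
   [i.+1]. *)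
have le0 l' : size l' = m ->
    join_kf (chain (nseq i ord0)) (chain (ord0 :: nseq m ord0)) <=
    join_kf (chain (nseq i ord0)) (chain (ord0 :: l')).
  by move=> sz'; rewrite !join_kf_chain; apply: (IH _ i.+1).
(* Head letter 2: flip the right part to get head 0 and the mirrored tail. Both parts then have
   nonpositive difference, so the flip does not increase the index. *)
have le2 : join_kf (chain (nseq i ord0)) (chain (ord0 :: nseq m ord0)) <=
           join_kf (chain (nseq i ord0)) (chain (ord_max :: l)).
  apply: le_trans (le0 (map (@rev_ord 3) l) _) _; first by rewrite size_map.
  have -> : chain (ord_max :: l) = flip (chain (ord0 :: map (@rev_ord 3) l)).
    rewrite flip_chain /= (mapK (@rev_ordK 3)).
    by congr (hexagon _ _).
  by apply: join_kf_flip_le; rewrite ?admissible_chain ?nseq0_diff ?chain0_diff.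
case: k => -[|[|[|//]]] kP; last exact: le2.
- by apply: le0.
- have hl := admissible_chain l.
  have [] := join_kf_hexagon1 (admissible_chain (nseq i ord0))
    (admissible_square hl) (square_res_le1 hl).
  + exact: le_trans (le0 l sz).
  + exact: le_trans le2.
Qed.

(** Handing over all the hexagons turns the reversed chain into two end hexagons with [l] between
    them, the case of an empty prefix. *)
Lemma ps_kf_chain_min l :
  ps_kf (chain (ord0 :: nseq (size l) ord0)) <= ps_kf (chain (ord0 :: rev l)).
Proof.
rewrite -[nseq _ _]rev_nseq !ps_kf_chain0 !join_kf_rev.
exact: (join_kf_nseq0_le 0 l).
Qed.

End PortStates.

(** * Resistances in two-port graphs *)

Section Realization.
Variables (R : realFieldType) (T : eqType).
Implicit Types (vs : seq T) (es : seq (T * T)) (r : T -> T -> R) (u v x y : T).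

(** Edges are listed with an arbitrary orientation, so that adding an edge adds exactly one
    summand. *)
Definition edge_laplacian es (f : T -> R) x : R :=
  \sum_(e <- es) ((x == e.1)%:R - (x == e.2)%:R) * (f e.1 - f e.2).

Lemma edge_laplacian_cons u v es f x : edge_laplacian ((u, v) :: es) f x =
  ((x == u)%:R - (x == v)%:R) * (f u - f v) + edge_laplacian es f x.
Proof. by rewrite /edge_laplacian big_cons. Qed.

Lemma eq_edge_laplacian es f g x :
    {in es, forall e, f e.1 - f e.2 = g e.1 - g e.2} ->
  edge_laplacian es f x = edge_laplacian es g x.
Proof. by move=> fg; apply: eq_big_seq => e /fg ->. Qed.

Lemma edge_laplacianD es f g x :
  edge_laplacian es (fun z => f z + g z) x =
  edge_laplacian es f x + edge_laplacian es g x.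
Proof. by rewrite -big_split; apply: eq_bigr => e _ /=; ring. Qed.

Lemma edge_laplacianZ es (c : R) f x :
  edge_laplacian es (fun z => c * f z) x = c * edge_laplacian es f x.
Proof. by rewrite mulr_sumr; apply: eq_bigr => e _ /=; ring. Qed.

(* [h] does not depend on [p]: potentials are differences of columns of [r]. *)
Record resistive vs es r : Prop := Resistive {
  resistive_edge : {in es, forall e, (e.1 \in vs) && (e.2 \in vs)};
  resistiveC : forall p q, r p q = r q p;
  resistive0 : forall p, r p p = 0;
  resistive_laplacian : exists h : T -> R, {in vs, forall p, forall x,
    edge_laplacian es (r^~ p) x = 2 * (h x - (x == p)%:R)} }.

Lemma resistive_potential vs es r p q x : resistive vs es r ->
    p \in vs -> q \in vs ->
  edge_laplacian es (fun z => (r z q - r z p) / 2) x = (x == p)%:R - (x == q)%:R.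
Proof.
case=> _ _ _ [h hL] pvs qvs.
transitivity (2^-1 * edge_laplacian es (r^~ q) x +
              (- 2^-1) * edge_laplacian es (r^~ p) x); last by rewrite !hL //; field.
rewrite -!edge_laplacianZ -edge_laplacianD.
by apply: eq_edge_laplacian => e _ /=; ring.
Qed.

Definition pendant_res r u x p q :=
  r (if p == x then u else p) (if q == x then u else q)
  + ((p == x) != (q == x))%:R.

Lemma resistive_pendant vs es r u x : u \in vs -> x \notin vs ->
  resistive vs es r -> resistive (x :: vs) ((x, u) :: es) (pendant_res r u x).
Proof.
move=> uvs xvs [eV rC r0 [h hL]].
have nx z : z \in vs -> (z == x) = false.
  by move=> zvs; apply: contraNF xvs => /eqP <-.
split.
- move=> e; rewrite inE => /predU1P[-> /=|/eV/andP[e1 e2]].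
    by rewrite !inE eqxx uvs orbT.
  by rewrite !inE e1 e2 !orbT.
- by move=> p q; rewrite /pendant_res rC (eq_sym (p == x)).
- by move=> p; rewrite /pendant_res r0 eqxx addr0.
(* For an old p, the potential drops by 1 from x to u, so the new edge adds this term to 2 h; the
   column of x satisfies the same equation. *)
exists (fun y => h y + ((y == x)%:R - (y == u)%:R) / 2) => p + y.
rewrite edge_laplacian_cons inE => /predU1P[->|pvs].
  rewrite (@eq_edge_laplacian _ _ (r^~ u)) => [|e /eV/andP[e1 e2]].
    by rewrite hL // /pendant_res !eqxx (nx u) //= !r0 /=; field.
  by rewrite /pendant_res /= !(nx _ e1, nx _ e2) ?eqxx /=; ring.
rewrite (@eq_edge_laplacian _ _ (r^~ p)) => [|e /eV/andP[e1 e2]].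
  by rewrite hL // /pendant_res eqxx (nx p) // (nx u) //=; field.
by rewrite /pendant_res !nx //=; ring.
Qed.

(** With D = r(.,u) - r(.,v), a unit current from p to q creates the voltage (D q - D p) / 2 between
    the ports; a unit edge there gives this rank-one (Sherman-Morrison) correction. *)
Definition close_res r u v p q :=
  r p q - ((r p u - r p v) - (r q u - r q v)) ^+ 2 / (4 * (1 + r u v)).

Lemma resistive_close vs es r u v : u \in vs -> v \in vs -> 0 <= r u v ->
  resistive vs es r -> resistive vs ((u, v) :: es) (close_res r u v).
Proof.
move=> uvs vvs ruv [eV rC r0 [h hL]]; split.
- by move=> e; rewrite inE => /predU1P[->|/eV //]; rewrite /= uvs vvs.
- by move=> p q; rewrite /close_res rC; congr (_ - _ / _); ring.
- by move=> p; rewrite /close_res r0 subrr expr0n mul0r subr0.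
pose d z := r z u - r z v.
pose c := (4 * (1 + r u v))^-1.
have dL y : edge_laplacian es d y = 2 * ((y == v)%:R - (y == u)%:R).
  transitivity (edge_laplacian es (r^~ u) y + (-1) * edge_laplacian es (r^~ v) y).
    rewrite -edge_laplacianZ -edge_laplacianD.
    by apply: eq_edge_laplacian => e _; rewrite /d; ring.
  by rewrite !hL //; ring.
(* In (d z - d p)^2 only the part d z ^ 2 is free of p and non-constant in z, so it goes into h; the
   Laplacian of the linear part cancels the current through the new edge. *)
exists (fun y => h y - c / 2 * edge_laplacian es (fun z => d z ^+ 2) y) => p pvs y.
rewrite edge_laplacian_cons.
have -> : edge_laplacian es ((close_res r u v)^~ p) y =
    edge_laplacian es (r^~ p) y + ((- c) * edge_laplacian es (fun z => d z ^+ 2) y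
      + 2 * c * d p * edge_laplacian es d y).
  rewrite -!edge_laplacianZ -!edge_laplacianD.
  by apply: eq_edge_laplacian => e _; rewrite /close_res /d /c; ring.
rewrite hL // dL /close_res !r0 (rC v u) (rC u p) (rC v p) /c /d.
by field; lra.
Qed.

Definition port_state_of vs r u v : port_state R :=
  PortState (size vs)%:R (r u v) (\sum_(p <- vs) (r p u - r p v))
    (\sum_(p <- vs) (r p u - r p v) ^+ 2) (\sum_(p <- vs) (r p u + r p v))
    ((\sum_(p <- vs) \sum_(q <- vs) r p q) / 2).

Definition realizes vs es u v (s : port_state R) : Prop :=
  [/\ uniq vs, u \in vs, v \in vs &
    exists2 r, resistive vs es r & s = port_state_of vs r u v].

Lemma realizes_edge u v : u != v ->
  realizes [:: u; v] [:: (u, v)] u v (edge_state R).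
Proof.
move=> uv; split; rewrite /= ?inE ?eqxx ?orbT ?andbT //.
pose r (p q : T) : R := (p != q)%:R.
exists r.
  split.
  - by move=> e; rewrite mem_seq1 => /eqP -> /=; rewrite !inE !eqxx orbT.
  - by move=> p q; rewrite /r eq_sym.
  - by move=> p; rewrite /r eqxx.
  exists (fun x => ((x == u)%:R + (x == v)%:R) / 2) => p + x.
  rewrite edge_laplacian_cons /edge_laplacian big_nil addr0 /r.
  by rewrite !inE => /orP[]/eqP->; rewrite ?eqxx ?[v == u]eq_sym uv /=; field.
rewrite /port_state_of !big_cons !big_nil /r !eqxx /= [v == u]eq_sym uv /=.
by congr PortState; field.
Qed.

Lemma realizes_flip vs es u v s :
  realizes vs es u v s -> realizes vs es v u (flip s).
Proof.
case=> vsU uvs vvs [r rP ->]; split=> //; exists r => //.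
rewrite /port_state_of /= (resistiveC rP v u); congr PortState.
- by rewrite -sumrN; apply: eq_bigr => p _; ring.
- by apply: eq_bigr => p _; ring.
- by apply: eq_bigr => p _; ring.
Qed.

Lemma realizes_top x vs es u v s : x \notin vs -> realizes vs es u v s ->
  realizes (x :: vs) ((x, u) :: es) x v (top s).
Proof.
move=> xvs [vsU uvs vvs [r rP ->]].
have [_ rC r0 _] := rP.
have nx z : z \in vs -> (z == x) = false.
  by move=> zvs; apply: contraNF xvs => /eqP <-.
split; rewrite /= ?inE ?eqxx ?vvs ?orbT ?xvs //.
pose r' := pendant_res r u x.
exists r'; first exact: resistive_pendant.
have rx p : p \in vs -> r' p x = r p u + 1.
  by move=> pvs; rewrite /r' /pendant_res eqxx nx.
have rv p q : p \in vs -> q \in vs -> r' p q = r p q.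
  by move=> pvs qvs; rewrite /r' /pendant_res !nx //= addr0.
have xv p : p \in vs -> r' x p = r p u + 1.
  by move=> pvs; rewrite /r' /pendant_res eqxx nx //= rC.
have xx : r' x x = 0 by rewrite /r' /pendant_res !eqxx r0 addr0.
have sz : \sum_(p <- vs) (1 : R) = (size vs)%:R.
  by rewrite big_const_seq count_predT iter_addr_0.
rewrite /port_state_of !big_cons /= (xv v) // xx (rC v u).
congr PortState.
- by rewrite natr1.
- have -> : \sum_(p <- vs) (r' p x - r' p v) =
      \sum_(p <- vs) (r p u - r p v) + (size vs)%:R.
    by rewrite -sz -big_split; apply: eq_big_seq => p pvs /=; rewrite rx // rv //; ring.
  by ring.
- have -> : \sum_(p <- vs) (r' p x - r' p v) ^+ 2 =
      \sum_(p <- vs) (r p u - r p v) ^+ 2 +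
      (2 * \sum_(p <- vs) (r p u - r p v) + (size vs)%:R).
    rewrite -sz mulr_sumr -!big_split; apply: eq_big_seq => p pvs /=.
    by rewrite rx // rv //; ring.
  by ring.
- have -> : \sum_(p <- vs) (r' p x + r' p v) =
      \sum_(p <- vs) (r p u + r p v) + (size vs)%:R.
    by rewrite -sz -big_split; apply: eq_big_seq => p pvs /=; rewrite rx // rv //; ring.
  by ring.
- have su : \sum_(p <- vs) r p u = (\sum_(p <- vs) (r p u + r p v) +
      \sum_(p <- vs) (r p u - r p v)) / 2.
    by rewrite -big_split /= mulr_suml; apply: eq_bigr => p _; field.
  rewrite -su.
  have -> : \sum_(q <- vs) r' x q = \sum_(q <- vs) (r q u + 1).
    by apply: eq_big_seq => q /xv.
  rewrite big_split /= sz.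
  have -> : \sum_(j <- vs) \sum_(q <- x :: vs) r' j q =
      \sum_(p <- vs) (\sum_(q <- vs) r p q + (r p u + 1)).
    apply: eq_big_seq => p pvs; rewrite big_cons rx // addrC; congr (_ + _).
    by apply: eq_big_seq => q qvs; rewrite rv.
  by rewrite !big_split /= sz; field.
Qed.

Lemma realizes_close vs es u v s : 0 <= ps_res s -> realizes vs es u v s ->
  realizes vs ((u, v) :: es) u v (close s).
Proof.
move=> + [vsU uvs vvs [r rP s_def]]; rewrite s_def /= => ruv.
have [_ rC r0 _] := rP.
have c0 : 1 + r u v != 0 by apply/eqP; lra.
split=> //; exists (close_res r u v); first exact: resistive_close.
pose d p := r p u - r p v.
rewrite /port_state_of; congr PortState.
- by rewrite /close_res !r0 (rC v u); field.
- rewrite mulr_suml; apply: eq_bigr => p _.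
  by rewrite /close_res !r0 (rC v u); field.
- rewrite mulr_suml; apply: eq_bigr => p _.
  by rewrite /close_res !r0 (rC v u); field.
- have -> : (size vs)%:R * r u v ^+ 2 = \sum_(p <- vs) r u v ^+ 2.
    by rewrite big_const_seq count_predT iter_addr_0 mulr_natl.
  rewrite -big_split mulr_suml -sumrB; apply: eq_bigr => p _ /=.
  by rewrite /close_res !r0 (rC v u); field.
pose Q := \sum_(p <- vs) d p ^+ 2; pose D := \sum_(p <- vs) d p.
pose c := (4 * (1 + r u v))^-1.
(* Summing (d p - d q)^2 over q gives n d p ^ 2 + Q - 2 d p D, and over p as well 2 (n Q - D ^
   2). *)
have -> : \sum_(p <- vs) \sum_(q <- vs) close_res r u v p q =
  \sum_(p <- vs) (\sum_(q <- vs) r p q - c * ((size vs)%:R * d p ^+ 2 + Q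
     - 2 * d p * D)).
  apply: eq_bigr => p _; rewrite /D /Q mulr_sumr.
  have -> : (size vs)%:R * d p ^+ 2 = \sum_(q <- vs) d p ^+ 2.
    by rewrite big_const_seq count_predT iter_addr_0 mulr_natl.
  rewrite -big_split -sumrB mulr_sumr -sumrB; apply: eq_bigr => q _ /=.
  by rewrite /close_res /c /d; ring.
rewrite -/D -/Q sumrB -mulr_sumr sumrB big_split /= -!mulr_sumr -mulr_suml -mulr_sumr.
have -> : \sum_(p <- vs) Q = (size vs)%:R * Q.
  by rewrite big_const_seq count_predT iter_addr_0 mulr_natl.
by rewrite -/D -/Q /c; field.
Qed.

(** The port walks along a path leaving [vs] at [p 0]; the lists are reversed because the newest
    vertex comes first. *)
Lemma realizes_top_path (p : nat -> T) a vs es v s :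
    {in iota 0 a, forall k, p k.+1 \notin vs} ->
    {in iota 0 a &, injective (fun k => p k.+1)} ->
    realizes vs es (p 0%N) v s ->
  realizes ([seq p k.+1 | k <- rev (iota 0 a)] ++ vs)
    ([seq (p k.+1, p k) | k <- rev (iota 0 a)] ++ es) (p a) v (iter a (@top R) s).
Proof.
elim: a => [|a IH] pvs pI; first by [].
have sub : {subset iota 0 a <= iota 0 a.+1}.
  by move=> k; rewrite !mem_iota /= !add0n => /ltnW.
move=> h.
have {IH}h := IH (sub_in1 sub pvs) (sub_in2 sub pI) h.
have -> : rev (iota 0 a.+1) = a :: rev (iota 0 a).
  by rewrite -(addn1 a) iotaD rev_cat.
apply: realizes_top h; rewrite mem_cat negb_or pvs ?mem_iota ?add0n /= ?ltnSn // andbT.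
apply/mapP => -[k]; rewrite mem_rev => ka /pI.
rewrite (sub _ ka) mem_iota /= add0n ltnSn => /(_ isT isT) ak.
by move: ka; rewrite -ak mem_iota /= add0n ltnn.
Qed.

Lemma realizes_bot_path (p : nat -> T) a vs es u s :
    {in iota 0 a, forall k, p k.+1 \notin vs} ->
    {in iota 0 a &, injective (fun k => p k.+1)} ->
    realizes vs es u (p 0%N) s ->
  realizes ([seq p k.+1 | k <- rev (iota 0 a)] ++ vs)
    ([seq (p k.+1, p k) | k <- rev (iota 0 a)] ++ es) u (p a) (iter a (@bot R) s).
Proof.
move=> pvs pI /realizes_flip/(realizes_top_path pvs pI)/realizes_flip.
by rewrite (iter_flip _ _ (@flip_top R)) flipK.
Qed.

End Realization.

Lemma sum_rank_lt (R : realFieldType) (T : finType) (r : T -> T -> R) :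
    (forall p q, r p q = r q p) -> (forall p, r p p = 0) ->
  \sum_(p : T * T | (enum_rank p.1 < enum_rank p.2)%N) r p.1 p.2 =
  (\sum_p \sum_q r p q) / 2.
Proof.
move=> rC r0; set S := LHS.
suff -> : \sum_p \sum_q r p q = S + S by field.
rewrite pair_big /= (bigID (fun p => (enum_rank p.1 < enum_rank p.2)%N)) /=.
congr (_ + _).
rewrite (bigID (fun p => p.1 == p.2)) /= big1 ?add0r => [|[p q] /= /andP[_ /eqP->] //].
rewrite (reindex_inj (inv_inj (@swap_pairK T T))) /=.
by apply: eq_big => [[p q]|[p q] _] /=; rewrite // -leqNgt ltn_neqAle andbC
  [q == p]eq_sym -(inj_eq (@enum_rank_inj T)).
Qed.

(** * Subdivided ladders *)

Section SubdivDarts.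
Variables (V E : finType) (src tgt : E -> V) (m : E -> nat).
Let T := subdiv_vertex V m.
Let pt : E -> nat -> T := @subdiv_point V E src tgt m.

(** Oriented edges: injectivity of [dart] rules out loops and parallel edges in either direction. *)
Definition dart (d : E * bool) : V * V :=
  if d.2 then (src d.1, tgt d.1) else (tgt d.1, src d.1).

Lemma subdiv_point_inr e k t :
  pt e k = inr t -> tag t = e /\ (tagged t).+1 = k.
Proof.
by case: k => [|k] //=; case: insubP => // i _ <- [<-].
Qed.

Lemma subdiv_point_inl e k v : (k <= (m e).+1)%N -> pt e k = inl v ->
  (k = 0%N /\ v = src e) \/ (k = (m e).+1 /\ v = tgt e).
Proof.
case: k => [_ [<-]|k km] /=; first by left.
case: insubP => //; rewrite -leqNgt => mk [<-]; right; split=> //; lia.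
Qed.

Hypothesis dart_inj : injective dart.

Lemma src_neq_tgt e : src e <> tgt e.
Proof.
move=> st; have /dart_inj [] // : dart (e, true) = dart (e, false).
by rewrite /dart /= st.
Qed.

Lemma subdiv_point_inj e k k' : (k <= (m e).+1)%N -> (k' <= (m e).+1)%N ->
  pt e k = pt e k' -> k = k'.
Proof.
move=> km km'; case Ek: (pt e k) => [v|t] /esym Ek'.
  have st := @src_neq_tgt e.
  case: (subdiv_point_inl km Ek) => -[-> ve];
  by case: (subdiv_point_inl km' Ek') => -[-> ve'] //; case: st; rewrite -ve -ve'.
by have [_ <-] := subdiv_point_inr Ek; have [_ <-] := subdiv_point_inr Ek'.
Qed.

Definition subdiv_dart (d : {e : E & 'I_(m e).+1} * bool) : T * T :=
  let: e := tag d.1 in let: k := tagged d.1 in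
  if d.2 then (pt e k, pt e k.+1) else (pt e k.+1, pt e k).

(** A dart touching a subdivision vertex determines its edge. A dart between two original vertices
    comes from an unsubdivided edge, where the injectivity of [dart] applies. *)
Lemma subdiv_dart_inj : injective subdiv_dart.
Proof.
move=> [[e k] b] [[e' k'] b'] eq_d.
have kl := ltn_ord k; have kl' := ltn_ord k'.
have eq_pt : [/\ pt e k = pt e' k', pt e k.+1 = pt e' k'.+1 & b = b'] \/
    [/\ pt e k = pt e' k'.+1, pt e k.+1 = pt e' k' & b = ~~ b'].
  move: eq_d; rewrite /subdiv_dart /=.
  by case: (b); case: (b') => -[-> ->]; by [left | right].
have ee' : e = e'.
  case Ek: (pt e k) eq_pt => [v|t]; last first.
    have [te _] := subdiv_point_inr Ek.
    by case=> -[/esym/subdiv_point_inr[te' _] _ _]; rewrite -te -te'.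
  case Ek1: (pt e k.+1) => [v1|t]; last first.
    have [te _] := subdiv_point_inr Ek1.
    by case=> -[_ /esym/subdiv_point_inr[te' _] _]; rewrite -te -te'.
  move=> eq_pt.
  have [v' Ek'] : exists v', pt e' k' = inl v'.
    by case: eq_pt => -[? ? _]; [exists v | exists v1].
  have [v1' Ek1'] : exists v', pt e' k'.+1 = inl v'.
    by case: eq_pt => -[? ? _]; [exists v1 | exists v].
  move: (subdiv_point_inl (ltnW kl) Ek) (subdiv_point_inl kl Ek1).
  move: (subdiv_point_inl (ltnW kl') Ek') (subdiv_point_inl kl' Ek1').
  case=> -[k0' v'E]; last by lia.
  case=> -[k1' v1'E]; first by lia.
  case=> -[k0 vE]; last by lia.
  case=> -[k1 v1E]; first by lia.
  have /dart_inj [] // : dart (e, b) = dart (e', b').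
  rewrite /dart /= -vE -v1E -v'E -v1'E.
  by case: eq_pt; rewrite Ek' Ek1' => -[[->] [->] ->] //; case: (b').
move: k' kl' eq_d eq_pt; rewrite -{}ee' => k' kl' _.
case=> -[/subdiv_point_inj h1 /subdiv_point_inj h2 ->].
  by have /val_inj -> := h1 (ltnW kl) (ltnW kl').
by have := h1 (ltnW kl) kl'; have := h2 kl (ltnW kl'); lia.
Qed.

Lemma subdiv_dartP x y :
  reflect (exists d, subdiv_dart d = (x, y)) (subdiv src tgt x y).
Proof.
apply: (iffP existsP) => [[e /existsP[k /orP[]/andP[/eqP-> /eqP->]]]|].
- by exists (Tagged (fun e => 'I_(m e).+1) k, true).
- by exists (Tagged (fun e => 'I_(m e).+1) k, false).
case=> -[[e k] []] [<- <-]; exists e; apply/existsP; exists k; rewrite !eqxx //.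
by rewrite orbT.
Qed.

(** Each neighbour of x is reached by exactly one dart, so the sum over neighbours becomes a sum
    over path segments. *)
Lemma subdiv_laplacian (R : pzRingType) (f : T -> R) x :
  \sum_(y | subdiv src tgt x y) (f x - f y) =
  \sum_e \sum_(0 <= k < (m e).+1)
    ((x == pt e k)%:R - (x == pt e k.+1)%:R) * (f (pt e k) - f (pt e k.+1)).
Proof.
transitivity (\sum_(d | (subdiv_dart d).1 == x) (f x - f (subdiv_dart d).2)).
  rewrite (partition_big (fun d => (subdiv_dart d).2) (subdiv src tgt x)) /=.
    apply: eq_bigr => y /subdiv_dartP[d dxy].
    rewrite (big_pred1 d) ?dxy // => d' /=.
    by rewrite -(inj_eq subdiv_dart_inj) dxy; case: (subdiv_dart d').
  move=> d /eqP <-; apply/subdiv_dartP; exists d.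
  exact: surjective_pairing.
rewrite big_mkcond /=.
rewrite -(pair_bigA _ (fun t b => if (subdiv_dart (t, b)).1 == x then
  f x - f (subdiv_dart (t, b)).2 else 0)).
under [RHS]eq_bigr do rewrite big_mkord.
rewrite [RHS]sig_big_dep; apply: eq_bigr => -[e k] _.
rewrite big_bool -[LHS]/((if pt e k == x then f x - f (pt e k.+1) else 0) +
  (if pt e k.+1 == x then f x - f (pt e k) else 0)).
rewrite -[RHS]/(((x == pt e k)%:R - (x == pt e k.+1)%:R) *
  (f (pt e k) - f (pt e k.+1))).
move: (pt e k) (pt e k.+1) => a b; rewrite ![_ == x]eq_sym.
have [e1|_] := eqVneq x a; have [e2|_] := eqVneq x b;
  by rewrite -?e1 -?e2 ?subrr ?sub0r ?subr0 ?mul0r ?mul1r ?mulN1r ?addr0 ?add0r ?opprB.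
Qed.

End SubdivDarts.

Lemma ladder_dart_inj K : injective (dart (@ladder_src K) (@ladder_tgt K)).
Proof.
move=> [e b] [e' b'] eq_d.
have h1 := congr1 (fun z => z.1.1) eq_d; have h2 := congr1 (fun z => val z.1.2) eq_d.
have h3 := congr1 (fun z => z.2.1) eq_d; have h4 := congr1 (fun z => val z.2.2) eq_d.
move: {eq_d} h1 h2 h3 h4; case: b b' e e' => -[] [[c j]|j] [[c' j']|j'];
  rewrite /dart /= /bump /= ?add1n => h1 h2 h3 h4; try (by []); try (by lia);
  by congr (_, _); try (by congruence);
     do ?[congr inl | congr inr | congr (_, _) | apply: val_inj => /=]; try (by lia).
Qed.

Section LadderRealization.
Variables (R : realFieldType) (K : nat) (m : ladder_edge K -> nat).
Variable (mm : bool -> nat -> nat).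
Hypothesis m_inl : forall b j, m (inl (b, j)) = mm b j.
Hypothesis m_inr : forall j, m (inr j) = 0%N.

Let T := subdiv_vertex (ladder_vertex K) m.
Let pt : ladder_edge K -> nat -> T :=
  @subdiv_point _ _ (@ladder_src K) (@ladder_tgt K) m.

(** Each side receives its subdivision vertices and then, by the [.+1], the ladder vertex of the
    next column; [close] adds the rung. *)
Fixpoint ladder_state j : port_state R :=
  if j is i.+1 then
    close (iter (mm false i).+1 (@bot R) (iter (mm true i).+1 (@top R) (ladder_state i)))
  else edge_state R.

Lemma admissible_ladder j : admissible (ladder_state j).
Proof.
elim: j => [|j IH]; first exact: admissible_edge.
apply/admissible_close/admissible_iter; first exact: admissible_bot.
by apply: admissible_iter => //; apply: admissible_top.
Qed.

(** The stage at which an edge is complete: a horizontal edge arrives with its right end. *)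
Definition edge_column (e : ladder_edge K) : nat :=
  match e with inl (_, j) => j.+1 | inr j => j end.

Definition edge_side (e : ladder_edge K) : bool :=
  if e is inl (b, _) then b else true.

Definition vertex_column (x : T) : nat :=
  match x with inl (_, i) => i | inr t => edge_column (tag t) end.

Definition vertex_side (x : T) : bool :=
  match x with inl (b, _) => b | inr t => edge_side (tag t) end.

Lemma vertex_column_pt b j k : vertex_column (pt (inl (b, j)) k.+1) = j.+1.
Proof. by rewrite /pt /=; case: insubP => //=. Qed.

Lemma vertex_side_pt b j k : vertex_side (pt (inl (b, j)) k.+1) = b.
Proof. by rewrite /pt /=; case: insubP => //=. Qed.

Definition path_laplacian e (f : T -> R) x : R :=
  \sum_(0 <= k < (m e).+1)
    ((x == pt e k)%:R - (x == pt e k.+1)%:R) * (f (pt e k) - f (pt e k.+1)).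

Lemma edge_laplacian_path e es f x :
  edge_laplacian ([seq (pt e k.+1, pt e k) | k <- rev (iota 0 (m e).+1)] ++ es) f x =
  path_laplacian e f x + edge_laplacian es f x.
Proof.
rewrite /edge_laplacian big_cat big_map /= bigop.big_rev; congr (_ + _).
rewrite /path_laplacian /index_iota subn0; apply: eq_bigr => k _ /=.
ring.
Qed.

Lemma path_laplacian_rung (i : 'I_K.+1) f x : path_laplacian (inr i) f x =
  ((x == inl (true, i))%:R - (x == inl (false, i))%:R) *
  (f (inl (true, i)) - f (inl (false, i))).
Proof.
have pt1 : pt (inr i) 1 = inl (false, i).
  by rewrite -(m_inr i) [LHS]subdiv_point_last.
by rewrite /path_laplacian m_inr big_nat1 pt1.
Qed.

Lemma rung_not_subdivided i : 'I_(m (inr i)) -> False.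
Proof. by case=> k; rewrite m_inr. Qed.

Lemma ladder_realizes j (jK : (j < K.+1)%N) : exists vs es,
  [/\ realizes vs es (inl (true, Ordinal jK) : T) (inl (false, Ordinal jK))
        (ladder_state j),
      forall x, (x \in vs) = (vertex_column x <= j)%N &
      forall f x, edge_laplacian es f x =
        \sum_(e | (edge_column e <= j)%N) path_laplacian e f x].
Proof.
elim: j jK => [|j IH] jK.
  exists [:: inl (true, Ordinal jK); inl (false, Ordinal jK)].
  exists [:: (inl (true, Ordinal jK), inl (false, Ordinal jK))]; split.
  - exact: realizes_edge.
  - case=> [[b i]|[[[b i]|i] k]]; last by case: (rung_not_subdivided k).
    + rewrite !inE /=; apply/idP/idP => [/orP[]/eqP[_ ->] //|].
      rewrite leqn0 => /eqP i0.
      by rewrite (_ : i = Ordinal jK); [case: b; rewrite eqxx ?orbT | apply: val_inj].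
    + by rewrite !inE.
  move=> f x; rewrite (big_pred1 (inr (Ordinal jK))).
    by rewrite path_laplacian_rung edge_laplacian_cons /edge_laplacian big_nil addr0.
  case=> [[b i]|i] //=.
  by rewrite leqn0.
have hj : (j < K)%N by [].
have [vs [es [h vsE esE]]] := IH (ltnW jK).
pose e b : ladder_edge K := inl (b, Ordinal hj).
have pt0 b : pt (e b) 0 = inl (b, Ordinal (ltnW jK)).
  by congr (inl (_, _)); apply: val_inj.
have ptl b : pt (e b) (m (e b)).+1 = inl (b, Ordinal jK).
  by rewrite [LHS]subdiv_point_last; congr (inl (_, _)); apply: val_inj.
have ptI b : {in iota 0 (m (e b)).+1 &, injective (fun k => pt (e b) k.+1)}.
  move=> k k'; rewrite !mem_iota !add0n => /andP[_ km] /andP[_ km'] eq_pt.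
  by have [] := subdiv_point_inj (@ladder_dart_inj K) km km' eq_pt.
rewrite -(pt0 true) -(pt0 false) in h.
have ptF b k : pt (e b) k.+1 \notin vs by rewrite vsE vertex_column_pt ltnn.
have {}h := realizes_top_path (fun k _ => ptF true k) (ptI true) h.
rewrite ptl in h.
have ptF' : {in iota 0 (m (e false)).+1, forall k, pt (e false) k.+1 \notin
    [seq pt (e true) k.+1 | k <- rev (iota 0 (m (e true)).+1)] ++ vs}.
  move=> k _; rewrite mem_cat negb_or ptF andbT.
  by apply/mapP => -[k' _] /(congr1 vertex_side); rewrite !vertex_side_pt.
have {}h := realizes_bot_path ptF' (ptI false) h.
rewrite ptl in h.
have {}h := realizes_close _ h.
rewrite !m_inl in h.
eexists; eexists; split.
- apply: h; apply/admissible_res/admissible_iter; first exact: admissible_bot.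
  by apply: admissible_iter; [exact: admissible_top | exact: admissible_ladder].
- move=> x; rewrite !mem_cat vsE.
  apply/idP/idP.
    case/or3P=> [/mapP[k _ ->]|/mapP[k _ ->]|/leqW //];
    by rewrite vertex_column_pt.
  rewrite leq_eqVlt ltnS => /orP[/eqP xj|->]; last by rewrite !orbT.
  (* Every vertex of the new column, ladder vertex or subdivision vertex, is a point of index at
     least 1 on one of the two new paths. *)
  suff [b [k km ->]] : exists b, exists2 k, (k <= m (e b))%N & x = pt (e b) k.+1.
    case: b km => km; apply/or3P; [apply: Or32|apply: Or31]; apply/mapP; exists k => //;
    by rewrite mem_rev mem_iota -m_inl.
  case: x xj => [[b i]|[[[b i]|i] k]] xj; last by case: (rung_not_subdivided k).
    by exists b, (m (e b)) => //; rewrite ptl; congr (inl (_, _)); apply: val_inj.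
  have iE : i = Ordinal hj by apply: val_inj; case: xj.
  move: k xj; rewrite iE => k _; exists b, k; first exact/ltnW/ltn_ord.
  by rewrite /pt /= valK.
move=> f x; rewrite edge_laplacian_cons -!m_inl !edge_laplacian_path esE.
rewrite [RHS](bigD1 (inr (Ordinal jK))) //= path_laplacian_rung; congr (_ + _).
rewrite [RHS](bigD1 (e false)) /= ?leqnn //; congr (_ + _).
rewrite [RHS](bigD1 (e true)) /= ?leqnn //; congr (_ + _).
apply: eq_bigl => -[[b i]|i] /=.
  rewrite andbT ltnS -andbA.
  have eqE b' : (inl (b, i) != e b') = ~~ ((b == b') && (i == j :> nat)) by [].
  by rewrite !eqE; case: (b) => /=; lia.
rewrite !andbT (_ : (inr i != _) = (i != j.+1 :> nat)) //.
by lia.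
Qed.

End LadderRealization.

(** At the last column the realization covers the whole graph, and uniqueness of the voltage drop
    identifies its matrix with [resistance]. *)
Lemma kirchhoff_index_subdiv_ladder (R : realType) K (m : ladder_edge K -> nat)
    (mm : bool -> nat -> nat) :
    (forall b j, m (inl (b, j)) = mm b j) -> (forall j, m (inr j) = 0%N) ->
    connected_graph (subdiv (@ladder_src K) (@ladder_tgt K) (m := m)) ->
  kirchhoff_index R (subdiv (@ladder_src K) (@ladder_tgt K) (m := m)) =
  ps_kf (ladder_state R mm K).
Proof.
move=> m_inl m_inr conn; set adj := subdiv _ _ (m := m).
have adjC : symmetric adj by exact: subdiv_sym.
have [vs [es [[vsU _ _ [r rP ->]] vsE esE]]] :=
  ladder_realizes R m_inl m_inr (ltnSn K).
have vsT x : x \in vs.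
  rewrite vsE; case: x => [[b i]|[[[b i]|i] k]]; first exact: ltn_ord i.
    exact: ltn_ord i.
  by case: (rung_not_subdivided m_inr k).
have [_ rC r0 _] := rP.
have res p q : resistance R adj p q = r p q.
  rewrite (@resistanceE _ _ _ _ _ (fun z => (r z q - r z p) / 2)) //.
    by rewrite !r0 (rC q p); field.
  move=> x; rewrite (subdiv_laplacian (@ladder_dart_inj K)).
  rewrite -(resistive_potential x rP) // esE.
  by apply: eq_bigl => -[[b j]|j] /=; rewrite ?ltn_ord // -ltnS ltn_ord.
rewrite /kirchhoff_index (eq_bigr _ (fun p _ => res p.1 p.2)) sum_rank_lt //=.
have vsP : perm_eq (index_enum (subdiv_vertex (ladder_vertex K) m)) vs.
  by apply: uniq_perm; rewrite ?index_enum_uniq // => x; rewrite mem_index_enum vsT.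
rewrite (perm_big _ vsP); congr (_ / _).
by apply: eq_bigr => p _; rewrite (perm_big _ vsP).
Qed.

(** * Phenylene chains as states *)

Section PhenyleneState.
Variables (R : realType) (n : nat) (w : (n - 2)%N.-tuple 'I_3).
Hypothesis n_ge2 : (2 <= n)%N.

Let added_nat (b : bool) (j : nat) : nat :=
  if odd j then 0%N else if b then top_added w j./2 else (2 - top_added w j./2)%N.

Lemma ladder_state_square i : ladder_state R added_nat i.*2.+2 =
  square (ladder_state R added_nat i.*2.+1).
Proof. by rewrite [LHS]/= /added_nat /= odd_double. Qed.

Lemma ladder_state_hexagon i : ladder_state R added_nat i.*2.+1 =
  hexagon (top_added w i) (ladder_state R added_nat i.*2).
Proof.
rewrite /= /added_nat odd_double doubleK /hexagon /square /wings.
(* The ladder performs all [top] moves first, whereas the [top] of [square] comes after the [bot]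
   moves of [wings]. *)
by congr (close (bot _)); apply/esym/(iter_top_bot 1).
Qed.

(** The ladder grows from left to right while [chain] lists its newest hexagon first, hence the
    reversal. *)
Lemma ladder_state_prefix i : (i <= n - 2)%N ->
  ladder_state R added_nat i.*2.+1 = chain R (rev (take i w)).
Proof.
elim: i => [|i IH] in2.
  by rewrite take0 (ladder_state_hexagon 0).
rewrite ladder_state_hexagon doubleS ladder_state_square IH; last exact: ltnW.
rewrite (take_nth ord0) ?size_tuple // rev_rcons /top_added.
by rewrite (_ : (0 < i.+1 < n.-1)%N) //; lia.
Qed.

(** At the last hexagon the guard in [top_added] fails and yields 0, which puts both vertices on the
    bottom edge. *)
Lemma ladder_state_last :
  ladder_state R added_nat (2 * n - 1) = chain R (ord0 :: rev w).
Proof.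
have -> : (2 * n - 1 = (n - 2).+1.*2.+1)%N by lia.
rewrite ladder_state_hexagon doubleS ladder_state_square ladder_state_prefix //.
rewrite take_oversize ?size_tuple // /top_added.
by rewrite (_ : (0 < (n - 2).+1 < n.-1)%N = false) //; lia.
Qed.

Lemma kirchhoff_index_phenylene :
  kirchhoff_index R (phenylene w) = ps_kf (chain R (ord0 :: rev w)).
Proof.
rewrite -ladder_state_last; apply: kirchhoff_index_subdiv_ladder => //.
exact: phenylene_connected.
Qed.

End PhenyleneState.

Theorem mainTheorem1 (R : realType) (n : nat) (hn : (2 <= n)%N)
    (w : (n - 2).-tuple 'I_3) :
  (kirchhoff_index R (phenylene (helicene_word n))
     <= kirchhoff_index R (phenylene w))%R.
Proof.
rewrite !kirchhoff_index_phenylene //= rev_nseq.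
by rewrite -[in nseq _ _](size_tuple w); apply: ps_kf_chain_min.
Qed.
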